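(* Let $\lambda,\mu_1,\mu_2>0$ with $\lambda<\min\{\mu_1,\mu_2\}$, and let $R_\infty$ be the $R$-matrix of the tandem Jackson network with infinite waiting room at the first queue. Put $\rho_2=\lambda/\mu_2$ and let $\eta\in(0,1)$ be the unique zero in $(0,1)$ of $\tau(z)=-\lambda-\mu_1-\mu_2(1-z)+2\sqrt{\lambda\mu_1/z}$. (i) If $\mu_1\le\mu_2$, then for every $z\in[\eta,\mu_1/\mu_2)$ the system $\mathbf{w}R_\infty=z\mathbf{w}$ has a positive solution $\mathbf{w}=(w_0,w_1,\dots)\in\ell^1$. (ii) If $\mu_1>\mu_2$, then for every $z\in[\rho_2,1)$ the system $\mathbf{w}R_\infty=z\mathbf{w}$ has a positive solution $\mathbf{w}\in\ell^1$.
   Context: Vectors $\mathbf{w}$ are row vectors indexed by $\{0,1,2,\dots\}$; positive means all components are strictly positive. The tandem Jackson network with infinite waiting room at the first queue (Poisson arrivals at rate $\lambda$ to queue 1, exponential service rates $\mu_1$ at queue 1 and $\mu_2$ at queue 2) is the continuous-time Markov chain $(Y_t,J_t)$ on $\{0,1,\dots\}^2$, where the level $Y_t$ is the number in the second queue and the phase $J_t$ the number in the first queue. Its transitions are: $(k,j)\to(k,j+1)$ at rate $\lambda$; $(k,j)\to(k+1,j-1)$ at rate $\mu_1$ for $j\ge1$; $(k,j)\to(k-1,j)$ at rate $\mu_2$ for $k\ge1$. The blocks of its generator (indexed by phases) for upward level transitions, transitions within a level $k\ge1$, and downward transitions are: $Q_0(j,j-1)=\mu_1$ ($j\ge1$),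 other entries $0$; $Q_1(j,j+1)=\lambda$ ($j\ge0$), $Q_1(0,0)=-(\lambda+\mu_2)$, $Q_1(j,j)=-(\lambda+\mu_1+\mu_2)$ ($j\ge1$), other entries $0$; $Q_2=\mu_2 I$. $R_\infty$ is the minimal nonnegative solution of $Q_0+RQ_1+R^2Q_2=0$; equivalently, $R_\infty(i,j)$ equals the total expected time spent in $(k+1,j)$ before first return to level $k$, starting from $(k,i)$ with $k\ge1$, divided by the mean sojourn time in $(k,i)$. *)

(* Defs.v *)
From Stdlib Require Import Reals Arith.
From Coquelicot Require Import Coquelicot.
Open Scope R_scope.

Definition infvec := nat -> R.
Definition infmat := nat -> nat -> R.

(* [Series] is a total operator, so an entry of [imul A B] is meaningful only
   where the series converges; see [imul_cv]. *)
Definition imul (A B : infmat) : infmat :=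
  fun i j => Series (fun k => A i k * B k j).

Definition imul_cv (A B : infmat) : Prop :=
  forall i j, ex_series (fun k => A i k * B k j).

Definition nonneg_mat (A : infmat) : Prop := forall i j, 0 <= A i j.

(* Row index = phase before the transition, column index = phase after;
   the phase is the length of the first queue, the level that of the second. *)
Definition Q0 (mu1 : R) : infmat :=
  fun i j => if (i =? S j)%nat then mu1 else 0.

Definition Q1 (lambda mu1 mu2 : R) : infmat :=
  fun i j =>
    if (j =? S i)%nat then lambda
    else if (j =? i)%nat then
      match i with
      | O => - (lambda + mu2)
      | S _ => - (lambda + mu1 + mu2)
      end
    else 0.

Definition Q2 (mu2 : R) : infmat :=
  fun i j => if (i =? j)%nat then mu2 else 0.

(* Only the convergence of M * M has to be required: the columns of [Q1] and
   [Q2] have finite support, so the two other products always converge. *)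
Definition R_equation (A0 A1 A2 M : infmat) : Prop :=
  imul_cv M M /\
  forall i j, A0 i j + imul M A1 i j + imul (imul M M) A2 i j = 0.

Definition minimal_nonneg_solution (A0 A1 A2 M : infmat) : Prop :=
  nonneg_mat M /\ R_equation A0 A1 A2 M /\
  forall N : infmat, nonneg_mat N -> R_equation A0 A1 A2 N ->
    forall i j, M i j <= N i j.

Definition is_R_infty (lambda mu1 mu2 : R) (M : infmat) : Prop :=
  minimal_nonneg_solution (Q0 mu1) (Q1 lambda mu1 mu2) (Q2 mu2) M.

Definition tau (lambda mu1 mu2 z : R) : R :=
  - lambda - mu1 - mu2 * (1 - z) + 2 * sqrt (lambda * mu1 / z).

Definition positive_vec (w : infvec) : Prop := forall j, 0 < w j.

Definition in_ell1 (w : infvec) : Prop := ex_series (fun j => Rabs (w j)).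

(* w M = z w, including the convergence of every component of w M. *)
Definition left_eigen (w : infvec) (M : infmat) (z : R) : Prop :=
  forall j, is_series (fun i => w i * M i j) (z * w j).

(* Main.v *)
Require Import Defs.
From Stdlib Require Import Reals Lra Lia.
From Coquelicot Require Import Coquelicot.
Open Scope R_scope.

(** The components of a vector w with w (Q0 + z Q1 + z^2 Q2) = 0 satisfy a
    three-term recurrence whose characteristic polynomial is
      p(x) = mu1 x^2 - z (lambda + mu1 + mu2 (1 - z)) x + z lambda.
    Its roots x1 <= x2 are real exactly when tau(z) <= 0, and two values decide
    where they lie:
      p(1) = (1 - z) (mu1 - mu2 z),   p(z) = z (1 - z) (lambda - mu2 z).
    As x1 x2 = z lambda / mu1 < 1, the first one puts both roots below 1 when
    z < mu1 / mu2.  The boundary equation gives w_1 = (x1 + x2 - z) w_0, hence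
      w_{j+1} - x1 w_j = (x2 - z) x2^j w_0,
    so w is positive and summable as soon as z <= x2 < 1.  If z >= lambda / mu2,
    then p(z) <= 0, so the roots are real and z lies between them; if
    z < lambda / mu1, then z^2 < x1 x2, so z < x2.  One of the two
    always applies in the theorem ([characteristic_roots]).

    It remains to see that such a w is a left eigenvector of the minimal
    solution M, for the eigenvalue z.  Rewrite the matrix equation as a fixed
    point equation M = [step] M by dividing by the diagonal of -Q1.  The
    iterates of [step] from 0 increase to a solution, and that solution
    dominates M.  Two upper bounds survive the iteration and are therefore true
    of M ([R_infty_bounds]): w M <= z w, and mu2 M 1 <= Q0 1, which says that
    level k is reached again from level k + 1 with probability at most 1.

    Finally put u = z w - w M >= 0 ([subinvariant_left_eigen]).  Subtracting the
    matrix equation, multiplied by w on the left, from the equation for w gives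
      u (Q1 + M Q2) = - z mu2 u.
    By the row bound, the rows of Q1 + M Q2 sum to at most - mu2.  Summing over
    the phases yields mu2 |u| <= z mu2 |u|, and u = 0 because z < 1.  The same
    summation argument ([balance_bound]) proves the row bound for the iterates. *)

(** * Finite sums and series with nonnegative terms *)

Lemma sum_n_S (a : nat -> R) (n : nat) : sum_n a (S n) = sum_n a n + a (S n) :> R.
Proof. exact (sum_Sn a n). Qed.

Lemma sum_n_0 (a : nat -> R) : sum_n a 0 = a 0%nat :> R.
Proof. exact (sum_O a). Qed.

Lemma sum_n_Rext (a b : nat -> R) (K : nat) :
  (forall k, a k = b k :> R) -> sum_n a K = sum_n b K :> R.
Proof. intros H; exact (sum_n_ext a b K H). Qed.

Lemma sum_n_le (a b : nat -> R) (K : nat) :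
  (forall k, a k <= b k) -> sum_n a K <= sum_n b K.
Proof.
  intros H; induction K as [|K IH].
  - rewrite !sum_n_0; apply H.
  - rewrite !sum_n_S; specialize (H (S K)); lra.
Qed.

Lemma sum_n_nonneg (a : nat -> R) (K : nat) :
  (forall k, 0 <= a k) -> 0 <= sum_n a K.
Proof.
  intros H; induction K as [|K IH].
  - rewrite sum_n_0; apply H.
  - rewrite sum_n_S; specialize (H (S K)); lra.
Qed.

Lemma sum_n_linear (c d : R) (a b : nat -> R) (K : nat) :
  sum_n (fun k => c * a k + d * b k) K = c * sum_n a K + d * sum_n b K :> R.
Proof.
  induction K as [|K IH].
  - rewrite !sum_n_0; ring.
  - rewrite !sum_n_S, IH; ring.
Qed.

Lemma sum_n_scal (c : R) (a : nat -> R) (K : nat) :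
  sum_n (fun k => c * a k) K = c * sum_n a K :> R.
Proof.
  induction K as [|K IH].
  - rewrite !sum_n_0; ring.
  - rewrite !sum_n_S, IH; ring.
Qed.

Lemma term_le_sum_n (a : nat -> R) (k : nat) :
  (forall i, 0 <= a i) -> a k <= sum_n a k.
Proof.
  intros H; destruct k as [|k].
  - rewrite sum_n_0; lra.
  - rewrite sum_n_S; pose proof (sum_n_nonneg a k H); lra.
Qed.

Lemma nonneg_ex_series (a : nat -> R) (B : R) :
  (forall k, 0 <= a k) -> (forall K, sum_n a K <= B) -> ex_series a.
Proof.
  intros Ha HB.
  destruct (ex_finite_lim_seq_incr (sum_n a) B) as [l Hl].
  - intros n; rewrite sum_n_S; specialize (Ha (S n)); lra.
  - exact HB.
  - exists l; exact Hl.
Qed.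

Lemma Series_le_bound (a : nat -> R) (B : R) :
  ex_series a -> (forall K, sum_n a K <= B) -> Series a <= B.
Proof.
  intros Ha HB.
  exact (is_lim_seq_le (sum_n a) (fun _ => B) (Series a) B HB
           (Series_correct a Ha) (is_lim_seq_const B)).
Qed.

Lemma sum_n_le_Series (a : nat -> R) (K : nat) :
  (forall k, 0 <= a k) -> ex_series a -> sum_n a K <= Series a.
Proof.
  intros Ha Hex.
  apply (is_lim_seq_incr_compare (sum_n a) (Series a)).
  - exact (Series_correct a Hex).
  - intros n; rewrite sum_n_S; specialize (Ha (S n)); lra.
Qed.

Lemma Series_nonneg (a : nat -> R) :
  (forall k, 0 <= a k) -> ex_series a -> 0 <= Series a.
Proof.
  intros Ha Hex.
  apply Rle_trans with (sum_n a 0).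
  - rewrite sum_n_0; apply Ha.
  - now apply sum_n_le_Series.
Qed.

Lemma nonneg_ex_series_le (a b : nat -> R) :
  (forall k, 0 <= a k <= b k) -> ex_series b -> ex_series a.
Proof.
  intros H Hb.
  apply nonneg_ex_series with (Series b).
  - intros k; apply H.
  - intros K; apply Rle_trans with (sum_n b K).
    + apply sum_n_le; apply H.
    + apply sum_n_le_Series; trivial.
      intros k; destruct (H k); lra.
Qed.

Lemma ex_series_Rscal (c : R) (a : nat -> R) :
  ex_series a -> ex_series (fun k => c * a k).
Proof. exact (ex_series_scal_l c a). Qed.

Lemma is_series_Rext (a b : nat -> R) (l : R) :
  (forall k, a k = b k :> R) -> is_series a l -> is_series b l.
Proof. exact (is_series_ext a b l). Qed.

Lemma is_series_Rplus (a b : nat -> R) (la lb : R) :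
  is_series a la -> is_series b lb -> is_series (fun k => a k + b k) (la + lb).
Proof. exact (is_series_plus a b la lb). Qed.

Lemma is_series_Rscal (c : R) (a : nat -> R) (l : R) :
  is_series a l -> is_series (fun k => c * a k) (c * l).
Proof. exact (is_series_scal_l c a l). Qed.

Lemma sum_n_Series (f : nat -> nat -> R) (K : nat) :
  (forall i, ex_series (f i)) ->
  is_series (fun k => sum_n (fun i => f i k) K) (sum_n (fun i => Series (f i)) K).
Proof.
  intros H; induction K as [|K IH].
  - rewrite sum_n_0.
    apply is_series_Rext with (f 0%nat).
    + intros k; now rewrite sum_n_0.
    + now apply Series_correct.
  - rewrite sum_n_S.
    apply is_series_Rext with (fun k => sum_n (fun i => f i k) K + f (S K) k).
    + intros k; now rewrite sum_n_S.
    + exact (is_series_Rplus _ _ _ _ IH (Series_correct _ (H (S K)))).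
Qed.

Lemma is_lim_seq_sum_n (f : nat -> nat -> R) (l : nat -> R) (K : nat) :
  (forall k, is_lim_seq (fun n => f n k) (l k)) ->
  is_lim_seq (fun n => sum_n (f n) K) (sum_n l K).
Proof.
  intros H; induction K as [|K IH].
  - rewrite sum_n_0.
    apply is_lim_seq_ext with (fun n => f n 0%nat); trivial.
    intros n; now rewrite sum_n_0.
  - rewrite sum_n_S.
    apply is_lim_seq_ext with (fun n => sum_n (f n) K + f n (S K)).
    + intros n; now rewrite sum_n_S.
    + apply is_lim_seq_plus'; trivial.
Qed.

Lemma is_lim_seq_Rle (u v : nat -> R) (a b : R) :
  (forall n, u n <= v n) -> is_lim_seq u a -> is_lim_seq v b -> a <= b.
Proof. intros H Hu Hv; exact (is_lim_seq_le u v a b H Hu Hv). Qed.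

(** The index is tested through an arbitrary boolean function because the
    generator blocks test indices in several forms. *)
Lemma sum_n_delta (p : nat -> bool) (m : nat) (f : nat -> R) (K : nat) :
  (forall k, p k = true <-> k = m) ->
  sum_n (fun k => if p k then f k else 0) K 
  = (if (m <=? K)%nat then f m else 0) :> R.
Proof.
  intros Hp; induction K as [|K IH].
  - rewrite sum_n_0.
    destruct (p 0%nat) eqn:E; destruct (Nat.leb_spec m 0) as [L|L]; trivial.
    + apply Hp in E; now subst.
    + apply Hp in E; lia.
    + assert (p 0%nat = true) by (apply Hp; lia); congruence.
  - rewrite sum_n_S, IH.
    destruct (p (S K)) eqn:E; destruct (Nat.leb_spec m K) as [L|L];
      destruct (Nat.leb_spec m (S K)) as [L'|L']; try lia; try ring.
    + apply Hp in E; lia.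
    + apply Hp in E; subst; ring.
    + apply Hp in E; lia.
    + assert (p (S K) = true) by (apply Hp; lia); congruence.
Qed.

Lemma is_series_delta (p : nat -> bool) (m : nat) (f : nat -> R) :
  (forall k, p k = true <-> k = m) ->
  is_series (fun k => if p k then f k else 0) (f m).
Proof.
  intros Hp.
  apply (is_lim_seq_ext_loc (fun _ => f m) _ (f m)).
  - exists m; intros n Hn; symmetry.
    etransitivity; [exact (sum_n_delta p m f n Hp)|].
    apply Nat.leb_le in Hn; now rewrite Hn.
  - apply is_lim_seq_const.
Qed.

Lemma sum_n_zero (K : nat) : sum_n (fun _ => 0) K = 0 :> R.
Proof.
  induction K as [|K IH]; [apply sum_n_0 | rewrite sum_n_S, IH; ring].
Qed.

(** * The fixed point form of the matrix equation *)

(** Row form of a phase increment: the row a becomes (0, a_0, a_1, ...). *)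
Definition shift (a : nat -> R) : nat -> R :=
  fun j => match j with O => 0 | S i => a i end.

Definition busy : nat -> R :=
  fun j => match j with O => 0 | S _ => 1 end.

(** Minus the diagonal of [Q1]. *)
Definition exit_rate (lambda mu1 mu2 : R) (j : nat) : R :=
  lambda + mu2 + mu1 * busy j.

Lemma busy_bounds (j : nat) : 0 <= busy j <= 1.
Proof. destruct j; simpl; lra. Qed.

Lemma exit_rate_pos (lambda mu1 mu2 : R) (j : nat) :
  0 < lambda -> 0 < mu1 -> 0 < mu2 -> 0 < exit_rate lambda mu1 mu2 j.
Proof.
  intros H1 H2 H3; unfold exit_rate.
  destruct (busy_bounds j) as [H _].
  pose proof (Rmult_le_pos mu1 (busy j)); lra.
Qed.

Lemma shift_le (a b : nat -> R) :
  (forall j, a j <= b j) -> forall j, shift a j <= shift b j.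
Proof. intros H [|j]; simpl; [lra | apply H]. Qed.

Lemma sum_n_shift_le (a : nat -> R) (K : nat) :
  (forall j, 0 <= a j) -> sum_n (shift a) K <= sum_n a K.
Proof.
  intros Ha.
  destruct K as [|K].
  - rewrite !sum_n_0; apply Ha.
  - rewrite sum_n_S; simpl.
    apply Rle_trans with (sum_n a K);
      [|rewrite sum_n_S; specialize (Ha (S K)); lra].
    clear Ha; induction K as [|K IH].
    + rewrite !sum_n_0; simpl; lra.
    + rewrite !sum_n_S in *; simpl; lra.
Qed.

Lemma imul_Q1 (lambda mu1 mu2 : R) (M : infmat) (i j : nat) :
  imul M (Q1 lambda mu1 mu2) i j
  = lambda * shift (M i) j - exit_rate lambda mu1 mu2 j * M i j.
Proof.
  apply is_series_unique.
  pose proof (is_series_delta (fun k => (j =? k)%nat) j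
                (fun k => - exit_rate lambda mu1 mu2 k * M i k)) as Hdiag.
  assert (Hd : forall k, (j =? k)%nat = true <-> k = j)
    by (intros k; rewrite Nat.eqb_eq; split; congruence).
  specialize (Hdiag Hd).
  destruct j as [|j].
  - replace (lambda * shift (M i) 0 - exit_rate lambda mu1 mu2 0 * M i 0%nat)
      with (- exit_rate lambda mu1 mu2 0 * M i 0%nat) by (simpl; ring).
    apply is_series_Rext with (2 := Hdiag).
    intros k; unfold Q1, exit_rate; destruct k; simpl; ring.
  - pose proof (is_series_delta (fun k => (S j =? S k)%nat) j
                  (fun k => lambda * M i k)) as Hup.
    assert (Hu : forall k, (S j =? S k)%nat = true <-> k = j)
      by (intros k; rewrite Nat.eqb_eq; split; congruence).
    specialize (Hup Hu).
    replace (lambda * shift (M i) (S j) - exit_rate lambda mu1 mu2 (S j) * M i (S j))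
      with (lambda * M i j + - exit_rate lambda mu1 mu2 (S j) * M i (S j))
      by (simpl; ring).
    apply is_series_Rext with (2 := is_series_Rplus _ _ _ _ Hup Hdiag).
    intros k; unfold Q1, exit_rate; cbv beta.
    destruct (Nat.eqb_spec (S j) (S k)) as [E|E];
      destruct (Nat.eqb_spec (S j) k) as [E'|E']; try lia;
      destruct k; simpl; try lia; ring.
Qed.

Lemma imul_Q2 (mu2 : R) (A : infmat) (i j : nat) :
  imul A (Q2 mu2) i j = mu2 * A i j.
Proof.
  apply is_series_unique.
  pose proof (is_series_delta (fun k => (k =? j)%nat) j (fun k => mu2 * A i k)) as H.
  apply is_series_Rext with (2 := H (fun k => Nat.eqb_eq k j)).
  intros k; unfold Q2; destruct (k =? j)%nat; ring.
Qed.

Lemma R_equation_entry (lambda mu1 mu2 : R) (M : infmat) :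
  R_equation (Q0 mu1) (Q1 lambda mu1 mu2) (Q2 mu2) M <->
  imul_cv M M /\
  forall i j, exit_rate lambda mu1 mu2 j * M i j
              = Q0 mu1 i j + lambda * shift (M i) j + mu2 * imul M M i j.
Proof.
  split; intros [Hcv H]; split; trivial; intros i j; specialize (H i j);
    rewrite imul_Q1, imul_Q2 in *; lra.
Qed.

Lemma Q0_nonneg (mu1 : R) (i j : nat) : 0 < mu1 -> 0 <= Q0 mu1 i j.
Proof. intros H; unfold Q0; destruct (i =? S j)%nat; lra. Qed.

Lemma Q0_row_sum (mu1 : R) (i K : nat) :
  0 < mu1 -> sum_n (Q0 mu1 i) K <= mu1 * busy i.
Proof.
  intros H; destruct i as [|i]; unfold Q0.
  - simpl; rewrite sum_n_zero; lra.
  - rewrite (sum_n_delta (fun j => (S i =? S j)%nat) i (fun _ => mu1)).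
    + destruct (i <=? K)%nat; simpl; lra.
    + intros k; rewrite Nat.eqb_eq; split; congruence.
Qed.

Lemma is_series_Q0_col (mu1 : R) (w : infvec) (j : nat) :
  is_series (fun i => w i * Q0 mu1 i j) (mu1 * w (S j)).
Proof.
  pose proof (is_series_delta (fun i => (i =? S j)%nat) (S j) (fun i => mu1 * w i)) as H.
  apply is_series_Rext with (2 := H (fun k => Nat.eqb_eq k (S j))).
  intros i; unfold Q0; destruct (i =? S j)%nat; ring.
Qed.

(** * The probability balance *)

(** Nonnegativity together with mu2 M 1 <= Q0 1.  Finite partial sums are used
    so that the bound passes to entrywise limits. *)
Definition row_bounded (mu1 mu2 : R) (M : infmat) : Prop :=
  nonneg_mat M /\ forall i K, mu2 * sum_n (M i) K <= mu1 * busy i.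

Lemma row_bounded_entry (mu1 mu2 : R) (M : infmat) (i j : nat) :
  0 < mu1 -> 0 < mu2 -> row_bounded mu1 mu2 M -> M i j <= mu1 / mu2.
Proof.
  intros H1 H2 [Hnn Hrow].
  apply Rmult_le_reg_l with mu2; trivial.
  replace (mu2 * (mu1 / mu2)) with mu1 by (field; lra).
  pose proof (term_le_sum_n (M i) j (Hnn i)) as Ht.
  apply (Rmult_le_compat_l mu2) in Ht; [|lra].
  specialize (Hrow i j).
  destruct (busy_bounds i) as [_ Hb].
  apply (Rmult_le_compat_l mu1) in Hb; lra.
Qed.

Lemma row_bounded_summable (mu1 mu2 : R) (M : infmat) (i : nat) :
  0 < mu1 -> 0 < mu2 -> row_bounded mu1 mu2 M -> ex_series (M i).
Proof.
  intros H1 H2 [Hnn Hrow].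
  apply nonneg_ex_series with (mu1 * busy i / mu2); [apply Hnn|].
  intros K; apply Rmult_le_reg_l with mu2; trivial.
  replace (mu2 * (mu1 * busy i / mu2)) with (mu1 * busy i) by (field; lra).
  apply Hrow.
Qed.

Lemma row_bounded_ex_series (mu1 mu2 : R) (M : infmat) (a : nat -> R) (j : nat) :
  0 < mu1 -> 0 < mu2 -> row_bounded mu1 mu2 M ->
  (forall k, 0 <= a k) -> ex_series a ->
  ex_series (fun k => a k * M k j).
Proof.
  intros H1 H2 HM Ha Hs.
  apply nonneg_ex_series_le with (fun k => mu1 / mu2 * a k).
  - intros k; split.
    + apply Rmult_le_pos; [apply Ha | apply (proj1 HM)].
    + rewrite (Rmult_comm (mu1 / mu2)); apply Rmult_le_compat_l; trivial.
      now apply row_bounded_entry.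
  - now apply ex_series_Rscal.
Qed.

Lemma row_bounded_imul_cv (mu1 mu2 : R) (M : infmat) :
  0 < mu1 -> 0 < mu2 -> row_bounded mu1 mu2 M -> imul_cv M M.
Proof.
  intros H1 H2 HM i j.
  apply row_bounded_ex_series with mu1 mu2; trivial.
  - intros k; apply (proj1 HM).
  - now apply row_bounded_summable with mu1 mu2.
Qed.

(** The hypothesis is a flow balance: mass leaves phase j at rate
    [exit_rate] j, and enters it from a source q, by arrivals and through M.
    Summed over the phases, arrivals cancel the lambda part of the exit rate and
    the row bound makes the inflow through M cancel at most the mu1 part, so
    only mu2 times the total mass is left against the source.  Two vectors
    a <= a' occur because in the iteration the inflow comes from the previous
    iterate; with a = a' it treats the defect of an eigenvector. *)
Lemma balance_bound (lambda mu1 mu2 B : R) (M : infmat) (q a a' : nat -> R) :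
  0 < lambda -> 0 < mu1 -> 0 < mu2 -> row_bounded mu1 mu2 M ->
  (forall j, 0 <= a j <= a' j) -> ex_series a ->
  (forall K, sum_n q K <= B) ->
  (forall j, exit_rate lambda mu1 mu2 j * a' j
             <= q j + lambda * shift a j + mu2 * Series (fun k => a k * M k j)) ->
  ex_series a' /\ mu2 * Series a' <= B.
Proof.
  intros H0 H1 H2 HM Ha Hs Hq Hbal.
  assert (Ha0 : forall j, 0 <= a j) by apply Ha.
  assert (Ha'0 : forall j, 0 <= a' j)
    by (intros j; destruct (Ha j); lra).
  assert (Hcv : forall j, ex_series (fun k => a k * M k j))
    by (intros j; now apply row_bounded_ex_series with mu1 mu2).
  assert (Hbs : forall b : nat -> R, (forall j, 0 <= b j) -> ex_series b ->
                  ex_series (fun j => busy j * b j)).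
  { intros b Hb Hex; apply nonneg_ex_series_le with b; trivial.
    intros j; specialize (Hb j); destruct (busy_bounds j); split; nra. }
  (* Summing the transfer term over the columns first is where the row bound
     of M enters: row k of M sums to at most (mu1 / mu2) * busy k. *)
  assert (Htransfer : forall K,
            mu2 * sum_n (fun j => Series (fun k => a k * M k j)) K
            <= mu1 * Series (fun k => busy k * a k)).
  { intros K.
    rewrite <- (is_series_unique _ _ (sum_n_Series (fun j k => a k * M k j) K Hcv)).
    rewrite <- !Series_scal_l.
    apply Series_le; [|now apply ex_series_Rscal, Hbs].
    intros k; rewrite sum_n_scal.
    destruct HM as [Hnn Hrow]; specialize (Hrow k K).
    pose proof (sum_n_nonneg (M k) K (Hnn k)) as Hp.
    specialize (Ha0 k); split.
    - apply Rmult_le_pos; [lra|]; now apply Rmult_le_pos.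
    - apply (Rmult_le_compat_l (a k)) in Hrow; lra. }
  set (C := B + lambda * Series a + mu1 * Series (fun k => busy k * a k)).
  assert (Hpart : forall K, (lambda + mu2) * sum_n a' K
                            + mu1 * sum_n (fun j => busy j * a' j) K <= C).
  { intros K; rewrite <- sum_n_linear.
    apply Rle_trans with
      (sum_n (fun j => 1 * (1 * q j + lambda * shift a j)
                       + mu2 * Series (fun k => a k * M k j)) K).
    - apply sum_n_le; intros j; specialize (Hbal j); unfold exit_rate in Hbal; lra.
    - rewrite !sum_n_linear; unfold C.
      specialize (Hq K); specialize (Htransfer K).
      pose proof (sum_n_shift_le a K Ha0) as Hsh.
      pose proof (sum_n_le_Series a K Ha0 Hs) as Hle.
      assert (Hl : sum_n (shift a) K <= Series a) by lra.
      apply (Rmult_le_compat_l lambda) in Hl; lra. }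
  assert (Hb0 : forall j, 0 <= busy j * a' j)
    by (intros j; apply Rmult_le_pos; [apply busy_bounds | apply Ha'0]).
  assert (Hs' : ex_series a').
  { apply nonneg_ex_series with (C / (lambda + mu2)); trivial.
    intros K; apply Rmult_le_reg_l with (lambda + mu2); [lra|].
    replace ((lambda + mu2) * (C / (lambda + mu2))) with C by (field; lra).
    specialize (Hpart K); pose proof (sum_n_nonneg _ K Hb0) as Hp.
    apply (Rmult_le_compat_l mu1) in Hp; lra. }
  split; trivial.
  assert (Hlim : (lambda + mu2) * Series a'
                 + mu1 * Series (fun j => busy j * a' j) <= C).
  { apply is_lim_seq_Rle with
      (u := fun K => (lambda + mu2) * sum_n a' K
                     + mu1 * sum_n (fun j => busy j * a' j) K) (v := fun _ => C);
      trivial; [|apply is_lim_seq_const].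
    apply is_lim_seq_plus';
      apply (is_lim_seq_scal_l (sum_n _) _ (Finite (Series _)));
      [exact (Series_correct _ Hs') | exact (Series_correct _ (Hbs a' Ha'0 Hs'))]. }
  assert (Hc1 : Series a <= Series a') by (apply Series_le; trivial).
  assert (Hc2 : Series (fun k => busy k * a k) <= Series (fun k => busy k * a' k)).
  { apply Series_le; [|now apply Hbs].
    intros k; specialize (Ha k); destruct (busy_bounds k); split; nra. }
  unfold C in Hlim.
  apply (Rmult_le_compat_l lambda) in Hc1; [|lra].
  apply (Rmult_le_compat_l mu1) in Hc2; [|lra].
  lra.
Qed.

(** * Successive approximation *)

(** The matrix equation solved for the diagonal of [Q1]: all the remaining
    terms are nonnegative, which makes the map monotone. *)
Definition step (lambda mu1 mu2 : R) (M : infmat) : infmat :=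
  fun i j => (Q0 mu1 i j + lambda * shift (M i) j + mu2 * imul M M i j)
             / exit_rate lambda mu1 mu2 j.

Fixpoint approx (lambda mu1 mu2 : R) (n : nat) : infmat :=
  match n with
  | O => fun _ _ => 0
  | S n => step lambda mu1 mu2 (approx lambda mu1 mu2 n)
  end.

Lemma step_mult (lambda mu1 mu2 : R) (M : infmat) (i j : nat) :
  0 < lambda -> 0 < mu1 -> 0 < mu2 ->
  exit_rate lambda mu1 mu2 j * step lambda mu1 mu2 M i j
  = Q0 mu1 i j + lambda * shift (M i) j + mu2 * imul M M i j.
Proof.
  intros H0 H1 H2; unfold step; field.
  apply Rgt_not_eq; now apply exit_rate_pos.
Qed.

Lemma step_mono (lambda mu1 mu2 : R) (M N : infmat) :
  0 < lambda -> 0 < mu1 -> 0 < mu2 ->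
  nonneg_mat M -> row_bounded mu1 mu2 N -> (forall i j, M i j <= N i j) ->
  forall i j, step lambda mu1 mu2 M i j <= step lambda mu1 mu2 N i j.
Proof.
  intros H0 H1 H2 HM HN Hle i j.
  pose proof (exit_rate_pos lambda mu1 mu2 j H0 H1 H2) as Hd.
  apply Rmult_le_reg_l with (exit_rate lambda mu1 mu2 j); trivial.
  rewrite !step_mult; trivial.
  pose proof (shift_le (M i) (N i) (Hle i) j) as Hs.
  assert (Hp : imul M M i j <= imul N N i j).
  { apply Series_le; [|now apply row_bounded_imul_cv with mu1 mu2].
    intros k; split.
    - apply Rmult_le_pos; apply HM.
    - apply Rmult_le_compat; trivial; apply HM. }
  apply (Rmult_le_compat_l lambda) in Hs; [|lra].
  apply (Rmult_le_compat_l mu2) in Hp; [|lra].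
  lra.
Qed.

(** When M i lies below its image, the image satisfies the flow balance with source
    [Q0] i, whose total rate is at most mu1 * [busy] i. *)
Lemma step_row_bounded (lambda mu1 mu2 : R) (M : infmat) :
  0 < lambda -> 0 < mu1 -> 0 < mu2 -> row_bounded mu1 mu2 M ->
  (forall i j, M i j <= step lambda mu1 mu2 M i j) ->
  row_bounded mu1 mu2 (step lambda mu1 mu2 M).
Proof.
  intros H0 H1 H2 HM Hle.
  assert (Hnn : nonneg_mat (step lambda mu1 mu2 M))
    by (intros i j; apply Rle_trans with (M i j); [apply (proj1 HM) | apply Hle]).
  split; trivial; intros i K.
  destruct (balance_bound lambda mu1 mu2 (mu1 * busy i) M (Q0 mu1 i) (M i)
              (step lambda mu1 mu2 M i)) as [Hs Hb]; trivial.
  - intros j; split; [apply (proj1 HM) | apply Hle].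
  - now apply row_bounded_summable with mu1 mu2.
  - intros K'; now apply Q0_row_sum.
  - intros j; rewrite step_mult; trivial; apply Rle_refl.
  - pose proof (sum_n_le_Series _ K (Hnn i) Hs) as Hk.
    apply (Rmult_le_compat_l mu2) in Hk; lra.
Qed.

Lemma approx_increasing (lambda mu1 mu2 : R) (n : nat) :
  0 < lambda -> 0 < mu1 -> 0 < mu2 ->
  row_bounded mu1 mu2 (approx lambda mu1 mu2 n) /\
  forall i j, approx lambda mu1 mu2 n i j <= approx lambda mu1 mu2 (S n) i j.
Proof.
  intros H0 H1 H2; induction n as [|n [IHb IHi]].
  - split; [split|].
    + intros i j; simpl; lra.
    + intros i K; simpl; rewrite sum_n_zero.
      pose proof (Rmult_le_pos mu1 (busy i)); destruct (busy_bounds i); lra.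
    + intros i j; simpl.
      apply Rmult_le_reg_l with (exit_rate lambda mu1 mu2 j);
        [now apply exit_rate_pos|].
      rewrite step_mult; trivial.
      pose proof (Q0_nonneg mu1 i j H1) as Hq.
      assert (Hz : imul (fun _ _ => 0) (fun _ _ => 0) i j = 0).
      { apply is_series_unique.
        apply is_series_Rext with (fun k => if (k =? 0)%nat then 0 else 0).
        - intros k; destruct (k =? 0)%nat; ring.
        - apply (is_series_delta (fun k => (k =? 0)%nat) 0 (fun _ => 0)).
          intros k; apply Nat.eqb_eq. }
      rewrite Hz; destruct j; simpl; lra.
  - assert (Hb : row_bounded mu1 mu2 (approx lambda mu1 mu2 (S n)))
      by (now apply step_row_bounded).
    split; trivial.
    apply step_mono; trivial; apply (proj1 IHb).
Qed.

(** The row bound also bounds the entries, so the increasing approximations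
    converge; monotone convergence in the product makes the limit a solution. *)
Lemma approx_limit (lambda mu1 mu2 : R) :
  0 < lambda -> 0 < mu1 -> 0 < mu2 ->
  exists N : infmat,
    (forall i j, is_lim_seq (fun n => approx lambda mu1 mu2 n i j) (N i j)) /\
    row_bounded mu1 mu2 N /\
    R_equation (Q0 mu1) (Q1 lambda mu1 mu2) (Q2 mu2) N.
Proof.
  intros H0 H1 H2.
  set (P := approx lambda mu1 mu2).
  assert (HP : forall n, row_bounded mu1 mu2 (P n)) by
    (intros n; now apply approx_increasing).
  assert (Hinc : forall n i j, P n i j <= P (S n) i j) by
    (intros n; now apply approx_increasing).
  exists (fun i j => real (Lim_seq (fun n => P n i j))).
  set (N := fun i j => real (Lim_seq (fun n => P n i j))).
  assert (Hlim : forall i j, is_lim_seq (fun n => P n i j) (N i j)).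
  { intros i j.
    destruct (ex_finite_lim_seq_incr (fun n => P n i j) (mu1 / mu2)) as [l Hl].
    - intros n; apply Hinc.
    - intros n; now apply row_bounded_entry.
    - unfold N; rewrite (is_lim_seq_unique _ _ Hl); exact Hl. }
  assert (Hup : forall n i j, P n i j <= N i j).
  { intros n i j; apply (is_lim_seq_incr_compare (fun n => P n i j) (N i j));
      [apply Hlim | intros m; apply Hinc]. }
  assert (HN : row_bounded mu1 mu2 N).
  { split.
    - intros i j; apply Rle_trans with (P 0%nat i j); [apply (proj1 (HP 0%nat)) | apply Hup].
    - intros i K.
      apply is_lim_seq_Rle with (u := fun n => mu2 * sum_n (P n i) K)
        (v := fun _ => mu1 * busy i); [|
        apply (is_lim_seq_scal_l (fun n => sum_n (P n i) K) mu2 (Finite (sum_n (N i) K)));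
        apply is_lim_seq_sum_n; intros k; apply Hlim | apply is_lim_seq_const].
      intros n; apply (HP n). }
  split; [exact Hlim|]; split; trivial.
  apply R_equation_entry; split; [now apply row_bounded_imul_cv with mu1 mu2|].
  intros i j.
  pose proof (exit_rate_pos lambda mu1 mu2 j H0 H1 H2) as Hd.
  apply Rle_antisym.
  - rewrite <- step_mult; trivial.
    apply Rmult_le_compat_l; [lra|].
    apply is_lim_seq_Rle with (u := fun n => P (S n) i j)
      (v := fun _ => step lambda mu1 mu2 N i j); [| |apply is_lim_seq_const].
    + intros n; exact (step_mono _ _ _ _ _ H0 H1 H2 (proj1 (HP n)) HN (Hup n) i j).
    + apply (is_lim_seq_incr_1 (fun n => P n i j)); apply Hlim.
  - (* Monotone convergence: truncate the product to finitely many terms before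
       letting the approximations converge. *)
    assert (Hpart : forall K, Q0 mu1 i j + lambda * shift (N i) j
                              + mu2 * sum_n (fun k => N i k * N k j) K
                              <= exit_rate lambda mu1 mu2 j * N i j).
    { intros K.
      apply is_lim_seq_Rle with
        (u := fun n => Q0 mu1 i j + lambda * shift (P n i) j
                       + mu2 * sum_n (fun k => P n i k * P n k j) K)
        (v := fun _ => exit_rate lambda mu1 mu2 j * N i j);
        [| |apply is_lim_seq_const].
      - intros n.
        apply Rle_trans with (exit_rate lambda mu1 mu2 j * P (S n) i j);
          [|apply Rmult_le_compat_l; [lra | apply Hup]].
        unfold P; simpl; rewrite step_mult; trivial; fold (P n).
        apply Rplus_le_compat_l, Rmult_le_compat_l; [lra|].
        apply sum_n_le_Series; [|now apply row_bounded_imul_cv with mu1 mu2].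
        intros k; apply Rmult_le_pos; apply (proj1 (HP n)).
      - apply is_lim_seq_plus'; [apply is_lim_seq_plus'|].
        + apply is_lim_seq_const.
        + apply (is_lim_seq_scal_l (fun n => shift (P n i) j) lambda (Finite _)).
          destruct j; simpl; [apply is_lim_seq_const | apply Hlim].
        + apply (is_lim_seq_scal_l (fun n => sum_n (fun k => P n i k * P n k j) K)
                   mu2 (Finite _)).
          apply is_lim_seq_sum_n with (l := fun k => N i k * N k j).
          intros k; apply is_lim_seq_mult'; apply Hlim. }
    set (X := exit_rate lambda mu1 mu2 j * N i j) in *.
    set (Y := Q0 mu1 i j + lambda * shift (N i) j) in *.
    assert (Hs : imul N N i j <= (X - Y) / mu2).
    { apply Series_le_bound; [now apply row_bounded_imul_cv with mu1 mu2|].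
      intros K; apply Rmult_le_reg_l with mu2; trivial.
      replace (mu2 * ((X - Y) / mu2)) with (X - Y) by (field; lra).
      specialize (Hpart K); lra. }
    apply (Rmult_le_compat_l mu2) in Hs; [|lra].
    replace (mu2 * ((X - Y) / mu2)) with (X - Y) in Hs by (field; lra).
    lra.
Qed.
(** * Subinvariance is invariance *)

(** The columns of w (Q0 + z Q1 + z^2 Q2) = 0. *)
Definition geometric_balance (lambda mu1 mu2 z : R) (w : infvec) : Prop :=
  forall j, mu1 * w (S j) + lambda * z * shift w j + mu2 * z * z * w j
            = exit_rate lambda mu1 mu2 j * z * w j.

Definition subinvariant (z : R) (w : infvec) (M : infmat) : Prop :=
  forall j K, sum_n (fun i => w i * M i j) K <= z * w j.

Lemma subinvariant_ex_series (z : R) (w : infvec) (M : infmat) (j : nat) :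
  nonneg_mat M -> positive_vec w -> subinvariant z w M ->
  ex_series (fun i => w i * M i j).
Proof.
  intros HM Hw Hsub; apply nonneg_ex_series with (z * w j); [|apply Hsub].
  intros i; apply Rmult_le_pos; [specialize (Hw i); lra | apply HM].
Qed.

Lemma subinvariant_Series_le (z : R) (w : infvec) (M : infmat) (j : nat) :
  nonneg_mat M -> positive_vec w -> subinvariant z w M ->
  Series (fun i => w i * M i j) <= z * w j.
Proof.
  intros HM Hw Hsub; apply Series_le_bound; [|apply Hsub].
  now apply subinvariant_ex_series with z.
Qed.

Lemma step_subinvariant (lambda mu1 mu2 z : R) (w : infvec) (M : infmat) :
  0 < lambda -> 0 < mu1 -> 0 < mu2 -> 0 <= z ->
  row_bounded mu1 mu2 M -> positive_vec w ->
  geometric_balance lambda mu1 mu2 z w ->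
  subinvariant z w M -> subinvariant z w (step lambda mu1 mu2 M).
Proof.
  intros H0 H1 H2 Hz HM Hw Hgeo Hsub j K.
  pose proof (proj1 HM) as Hnn.
  assert (Hw0 : forall i, 0 <= w i) by (intros i; specialize (Hw i); lra).
  apply Rmult_le_reg_l with (exit_rate lambda mu1 mu2 j); [now apply exit_rate_pos|].
  rewrite <- sum_n_scal.
  apply Rle_trans with
    (sum_n (fun i => 1 * (1 * (w i * Q0 mu1 i j) + lambda * (w i * shift (M i) j))
                     + mu2 * (w i * imul M M i j)) K).
  { apply sum_n_le; intros i.
    replace (exit_rate lambda mu1 mu2 j * (w i * step lambda mu1 mu2 M i j))
      with (w i * (exit_rate lambda mu1 mu2 j * step lambda mu1 mu2 M i j)) by ring.
    rewrite step_mult; trivial; apply Req_le; ring. }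
  rewrite !sum_n_linear.
  assert (Hq : sum_n (fun i => w i * Q0 mu1 i j) K <= mu1 * w (S j)).
  { rewrite <- (is_series_unique _ _ (is_series_Q0_col mu1 w j)).
    apply sum_n_le_Series; [|eexists; apply is_series_Q0_col].
    intros i; apply Rmult_le_pos; [apply Hw0 | now apply Q0_nonneg]. }
  assert (Hs : sum_n (fun i => w i * shift (M i) j) K <= z * shift w j).
  { destruct j as [|j]; simpl; [|apply Hsub].
    apply Rle_trans with (sum_n (fun _ => 0) K).
    - apply sum_n_le; intros i; lra.
    - rewrite sum_n_zero; lra. }
  (* (w M) M is bounded by applying the hypothesis on w M twice. *)
  assert (Hp : sum_n (fun i => w i * imul M M i j) K <= z * (z * w j)).
  { assert (Hcv : forall i, ex_series (fun k => w i * (M i k * M k j)))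
      by (intros i; now apply ex_series_Rscal, row_bounded_imul_cv with mu1 mu2).
    apply Rle_trans with (Series (fun k => z * (w k * M k j))).
    - apply Rle_trans with (sum_n (fun i => Series (fun k => w i * (M i k * M k j))) K).
      { apply sum_n_le; intros i; unfold imul; rewrite Series_scal_l; lra. }
      rewrite <- (is_series_unique _ _ (sum_n_Series _ K Hcv)).
      apply Series_le;
        [|now apply ex_series_Rscal, subinvariant_ex_series with z].
      intros k.
      assert (Hr : sum_n (fun i => w i * (M i k * M k j)) K
                   = M k j * sum_n (fun i => w i * M i k) K).
      { rewrite <- sum_n_scal; apply sum_n_Rext; intros i; ring. }
      rewrite Hr; split.
      + apply Rmult_le_pos; [apply Hnn|].
        apply sum_n_nonneg; intros i; apply Rmult_le_pos; trivial; apply Hnn.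
      + specialize (Hsub k K); apply (Rmult_le_compat_l (M k j)) in Hsub;
          [lra | apply Hnn].
    - rewrite Series_scal_l; apply Rmult_le_compat_l; trivial.
      now apply subinvariant_Series_le. }
  specialize (Hgeo j).
  apply (Rmult_le_compat_l lambda) in Hs; [|lra].
  apply (Rmult_le_compat_l mu2) in Hp; [|lra].
  lra.
Qed.

Lemma approx_subinvariant (lambda mu1 mu2 z : R) (w : infvec) (n : nat) :
  0 < lambda -> 0 < mu1 -> 0 < mu2 -> 0 <= z ->
  positive_vec w -> geometric_balance lambda mu1 mu2 z w ->
  subinvariant z w (approx lambda mu1 mu2 n).
Proof.
  intros H0 H1 H2 Hz Hw Hgeo; induction n as [|n IH].
  - intros j K; simpl.
    apply Rle_trans with (sum_n (fun _ => 0) K).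
    + apply sum_n_le; intros i; lra.
    + rewrite sum_n_zero; apply Rmult_le_pos; trivial; specialize (Hw j); lra.
  - apply step_subinvariant; trivial; now apply approx_increasing.
Qed.

(** Both properties are upper bounds on the entries, so they descend from the
    limit of the approximations to the smaller minimal solution. *)
Lemma R_infty_bounds (lambda mu1 mu2 : R) (M : infmat) :
  0 < lambda -> 0 < mu1 -> 0 < mu2 -> is_R_infty lambda mu1 mu2 M ->
  row_bounded mu1 mu2 M /\
  forall z w, 0 <= z -> positive_vec w -> geometric_balance lambda mu1 mu2 z w ->
    subinvariant z w M.
Proof.
  intros H0 H1 H2 [Hnn [_ Hmin]].
  destruct (approx_limit lambda mu1 mu2 H0 H1 H2) as [N [Hlim [[HN Hrow] Heq]]].
  assert (Hle : forall i j, M i j <= N i j) by (now apply Hmin).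
  split; [split; trivial|].
  - intros i K; apply Rle_trans with (2 := Hrow i K).
    apply Rmult_le_compat_l; [lra|]; now apply sum_n_le.
  - intros z w Hz Hw Hgeo j K.
    apply Rle_trans with (sum_n (fun i => w i * N i j) K).
    + apply sum_n_le; intros i; apply Rmult_le_compat_l; trivial.
      specialize (Hw i); lra.
    + apply is_lim_seq_Rle with
        (u := fun n => sum_n (fun i => w i * approx lambda mu1 mu2 n i j) K)
        (v := fun _ => z * w j); [| |apply is_lim_seq_const].
      * intros n; now apply approx_subinvariant.
      * apply is_lim_seq_sum_n with (l := fun i => w i * N i j).
        intros i; apply (is_lim_seq_scal_l _ (w i) (Finite (N i j))), Hlim.
Qed.

(** The defect u = z w - w M satisfies the flow balance of [balance_bound] with
    source z mu2 u, so its mass U obeys mu2 U <= z mu2 U and vanishes.  The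
    summability of w is what makes U finite. *)
Lemma subinvariant_left_eigen (lambda mu1 mu2 z : R) (w : infvec) (M : infmat) :
  0 < lambda -> 0 < mu1 -> 0 < mu2 -> 0 <= z < 1 ->
  row_bounded mu1 mu2 M ->
  R_equation (Q0 mu1) (Q1 lambda mu1 mu2) (Q2 mu2) M ->
  positive_vec w -> ex_series w ->
  geometric_balance lambda mu1 mu2 z w ->
  subinvariant z w M -> left_eigen w M z.
Proof.
  intros H0 H1 H2 Hz HM HR Hw Hsw Hgeo Hsub.
  pose proof (proj1 HM) as Hnn.
  apply R_equation_entry in HR; destruct HR as [Hcv HR].
  assert (Hw0 : forall i, 0 <= w i) by (intros i; specialize (Hw i); lra).
  set (v := fun j => Series (fun i => w i * M i j)).
  assert (Hv : forall j, is_series (fun i => w i * M i j) (v j)).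
  { intros j; apply Series_correct; now apply subinvariant_ex_series with z. }
  assert (Hv0 : forall j, 0 <= v j).
  { intros j; apply Series_nonneg; [|now exists (v j)].
    intros i; apply Rmult_le_pos; [apply Hw0 | apply Hnn]. }
  set (u := fun j => z * w j - v j).
  assert (Hu0 : forall j, 0 <= u j).
  { intros j; pose proof (subinvariant_Series_le z w M j Hnn Hw Hsub) as H.
    unfold u, v; lra. }
  assert (Hsu : ex_series u).
  { apply nonneg_ex_series_le with (fun j => z * w j).
    - intros j; specialize (Hv0 j); specialize (Hu0 j); unfold u in *; lra.
    - now apply ex_series_Rscal. }
  assert (HwM : forall a, (forall k, 0 <= a k) -> ex_series a ->
                  forall j, ex_series (fun k => a k * M k j))
    by (intros a Ha Hsa j; now apply row_bounded_ex_series with mu1 mu2).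
  (* The convergence of w (M M) is read off from the matrix equation, whose
     other terms converge after multiplication by w. *)
  assert (HwR : forall j,
            is_series (fun i => w i * imul M M i j)
              (/ mu2 * (exit_rate lambda mu1 mu2 j * v j
                        + (- (mu1 * w (S j)) + - lambda * shift v j)))).
  { intros j.
    assert (Hsh : is_series (fun i => w i * shift (M i) j) (shift v j)).
    { destruct j as [|j]; simpl; [|apply Hv].
      apply is_series_Rext with (fun k => if (k =? 0)%nat then 0 else 0).
      - intros k; destruct (k =? 0)%nat; ring.
      - apply (is_series_delta (fun k => (k =? 0)%nat) 0 (fun _ => 0)).
        intros k; apply Nat.eqb_eq. }
    apply is_series_Rext with
      (fun i => / mu2 * (exit_rate lambda mu1 mu2 j * (w i * M i j)
                + (-1 * (w i * Q0 mu1 i j) + - lambda * (w i * shift (M i) j)))).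
    - intros i.
      replace (exit_rate lambda mu1 mu2 j * (w i * M i j))
        with (w i * (exit_rate lambda mu1 mu2 j * M i j)) by ring.
      rewrite HR; field; lra.
    - replace (- (mu1 * w (S j))) with (-1 * (mu1 * w (S j))) by ring.
      apply is_series_Rscal.
      apply is_series_Rplus.
      + apply is_series_Rscal, Hv.
      + apply is_series_Rplus.
        * apply is_series_Rscal, is_series_Q0_col.
        * apply is_series_Rscal, Hsh. }
  (* (w M) M <= w (M M), by truncating the inner product of M M. *)
  assert (Hassoc : forall j,
            Series (fun k => v k * M k j) <= Series (fun i => w i * imul M M i j)).
  { intros j; apply Series_le_bound.
    { apply nonneg_ex_series_le with (fun k => z * (w k * M k j)).
      - intros k; split; [apply Rmult_le_pos; [apply Hv0 | apply Hnn]|].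
        replace (z * (w k * M k j)) with (z * w k * M k j) by ring.
        apply Rmult_le_compat_r; [apply Hnn|].
        specialize (Hu0 k); unfold u in Hu0; lra.
      - now apply ex_series_Rscal, HwM. }
    intros K.
    assert (Hfin : is_series (fun i => sum_n (fun k => w i * M i k * M k j) K)
                     (sum_n (fun k => v k * M k j) K)).
    { assert (Hc : forall k, is_series (fun i => w i * M i k * M k j) (v k * M k j))
        by (intros k; rewrite Rmult_comm;
            apply is_series_Rext with (2 := is_series_Rscal (M k j) _ _ (Hv k));
            intros i; ring).
      replace (sum_n (fun k => v k * M k j) K)
        with (sum_n (fun k => Series (fun i => w i * M i k * M k j)) K)
        by (apply sum_n_Rext; intros k; now apply is_series_unique).
      apply (sum_n_Series (fun k i => w i * M i k * M k j)).
      intros k; eexists; apply Hc. }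
    rewrite <- (is_series_unique _ _ Hfin).
    apply Series_le; [|eexists; apply HwR].
    intros i; split.
    - apply sum_n_nonneg; intros k; repeat apply Rmult_le_pos; trivial; apply Hnn.
    - rewrite (sum_n_Rext _ (fun k => w i * (M i k * M k j))) by (intros k; ring).
      rewrite sum_n_scal; apply Rmult_le_compat_l; trivial.
      apply sum_n_le_Series; [|apply Hcv].
      intros k; apply Rmult_le_pos; apply Hnn. }
  assert (Hbal : forall j,
            exit_rate lambda mu1 mu2 j * u j
            <= mu2 * z * u j + lambda * shift u j + mu2 * Series (fun k => u k * M k j)).
  { intros j.
    assert (Hsplit : Series (fun k => u k * M k j)
                     = z * v j - Series (fun k => v k * M k j)).
    { unfold v at 1; rewrite <- Series_scal_l, <- Series_minus.
      - apply Series_ext; intros k; unfold u; ring.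
      - now apply ex_series_Rscal, HwM.
      - apply nonneg_ex_series_le with (fun k => z * (w k * M k j)).
        + intros k; split; [apply Rmult_le_pos; [apply Hv0 | apply Hnn]|].
          replace (z * (w k * M k j)) with (z * w k * M k j) by ring.
          apply Rmult_le_compat_r; [apply Hnn|].
          specialize (Hu0 k); unfold u in Hu0; lra.
        + now apply ex_series_Rscal, HwM. }
    assert (Hshu : shift u j = z * shift w j - shift v j)
      by (destruct j; simpl; [ring | reflexivity]).
    pose proof (Hassoc j) as Ha.
    rewrite (is_series_unique _ _ (HwR j)) in Ha.
    apply (Rmult_le_compat_l mu2) in Ha; [|lra].
    rewrite <- Rmult_assoc, Rinv_r, Rmult_1_l in Ha by lra.
    specialize (Hgeo j); rewrite Hsplit, Hshu; unfold u; lra. }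
  destruct (balance_bound lambda mu1 mu2 (mu2 * z * Series u) M
              (fun j => mu2 * z * u j) u u) as [_ Hmass]; trivial.
  { intros j; split; [apply Hu0 | apply Rle_refl]. }
  { intros K; rewrite sum_n_scal; apply Rmult_le_compat_l.
    - apply Rmult_le_pos; lra.
    - now apply sum_n_le_Series. }
  pose proof (Series_nonneg u Hu0 Hsu) as Hpos.
  assert (HU : Series u = 0).
  { assert (Hlt : 0 < mu2 * (1 - z)) by (apply Rmult_lt_0_compat; lra).
    assert (Hle : mu2 * (1 - z) * Series u <= 0) by lra.
    nra. }
  intros j.
  assert (Huj : u j = 0).
  { pose proof (term_le_sum_n u j Hu0) as Ht.
    pose proof (sum_n_le_Series u j Hu0 Hsu) as Hle.
    specialize (Hu0 j); lra. }
  replace (z * w j) with (v j) by (unfold u in Huj; lra).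
  apply Hv.
Qed.

(** * Solving the scalar recurrence *)

(** The solution alpha x1^j + beta x2^j with w_0 = 1 and w_1 = x1 + x2 - z,
    in a form that covers the double root and shows positivity when z <= x2. *)
Fixpoint two_root_vec (x1 x2 z : R) (j : nat) : R :=
  match j with
  | O => 1
  | S j => x1 * two_root_vec x1 x2 z j + (x2 - z) * x2 ^ j
  end.

Lemma two_root_vec_pos (x1 x2 z : R) :
  0 < x1 -> 0 < x2 -> z <= x2 -> positive_vec (two_root_vec x1 x2 z).
Proof.
  intros H1 H2 Hz j; induction j as [|j IH]; simpl; [lra|].
  pose proof (pow_lt x2 j H2) as Hp.
  pose proof (Rmult_lt_0_compat _ _ H1 IH).
  pose proof (Rmult_le_pos (x2 - z) (x2 ^ j)); lra.
Qed.

Lemma two_root_vec_ex_series (x1 x2 z : R) :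
  0 < x1 < 1 -> 0 < x2 < 1 -> z <= x2 -> ex_series (two_root_vec x1 x2 z).
Proof.
  intros H1 H2 Hz.
  set (w := two_root_vec x1 x2 z).
  assert (Hw : forall j, 0 <= w j)
    by (intros j; apply Rlt_le, two_root_vec_pos; lra).
  assert (Hgs : forall K, sum_n (fun j => x2 ^ j) K <= / (1 - x2)).
  { intros K.
    assert (Hg : is_series (fun j => x2 ^ j) (/ (1 - x2)))
      by (apply is_series_geom; rewrite Rabs_pos_eq; lra).
    rewrite <- (is_series_unique _ _ Hg).
    apply sum_n_le_Series; [|eexists; apply Hg].
    intros j; apply pow_le; lra. }
  set (C := 1 + (x2 - z) * / (1 - x2)).
  assert (Hrec : forall K, sum_n w (S K)
                           = 1 + x1 * sum_n w K + (x2 - z) * sum_n (fun j => x2 ^ j) K :> R).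
  { intros K; induction K as [|K IH].
    - rewrite sum_n_S, !sum_n_0; unfold w; simpl; ring.
    - rewrite sum_n_S, IH at 1; rewrite !sum_n_S.
      change (w (S (S K))) with (x1 * w (S K) + (x2 - z) * x2 ^ S K); ring. }
  apply nonneg_ex_series with (C / (1 - x1)); trivial.
  intros K.
  assert (Hn : sum_n w K <= sum_n w (S K))
    by (rewrite sum_n_S; specialize (Hw (S K)); lra).
  rewrite Hrec in Hn.
  specialize (Hgs K); apply (Rmult_le_compat_l (x2 - z)) in Hgs; [|lra].
  apply Rmult_le_reg_l with (1 - x1); [lra|].
  replace ((1 - x1) * (C / (1 - x1))) with C by (field; lra).
  unfold C; lra.
Qed.

Lemma two_root_vec_balance (lambda mu1 mu2 z x1 x2 : R) :
  mu1 * (x1 + x2) = z * (lambda + mu1 + mu2 * (1 - z)) ->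
  mu1 * (x1 * x2) = z * lambda ->
  geometric_balance lambda mu1 mu2 z (two_root_vec x1 x2 z).
Proof.
  intros Hsum Hprod j; unfold exit_rate; destruct j as [|j].
  - simpl; nra.
  - simpl; set (a := two_root_vec x1 x2 z j); set (p := x2 ^ j).
    (* x1 and x2 eliminated through their symmetric functions. *)
    transitivity ((mu1 * (x1 + x2) + mu2 * z * z) * (x1 * a + (x2 - z) * p)
                  + (lambda * z - mu1 * (x1 * x2)) * a).
    + ring.
    + rewrite Hsum, Hprod; ring.
Qed.

(** The alternative in the last hypothesis excludes x1 <= x2 < z: that ordering
    would give both p(z) > 0 and z^2 > x1 x2 = z lambda / mu1. *)
Lemma characteristic_roots (lambda mu1 mu2 z : R) :
  0 < lambda -> 0 < mu1 -> 0 < mu2 -> 0 < z < 1 ->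
  lambda < mu1 -> mu2 * z < mu1 ->
  4 * (z * lambda * mu1) <= (z * (lambda + mu1 + mu2 * (1 - z))) ^ 2 ->
  lambda <= mu2 * z \/ mu1 * z <= lambda ->
  exists x1 x2, 0 < x1 < 1 /\ 0 < x2 < 1 /\ z <= x2 /\
    mu1 * (x1 + x2) = z * (lambda + mu1 + mu2 * (1 - z)) /\
    mu1 * (x1 * x2) = z * lambda.
Proof.
  intros H0 H1 H2 Hz Hlm Hzm Hdisc Hcase.
  set (s := z * (lambda + mu1 + mu2 * (1 - z))) in *.
  set (D := sqrt (s ^ 2 - 4 * (z * lambda * mu1))).
  assert (HD0 : 0 <= D) by apply sqrt_pos.
  assert (HD : D * D = s ^ 2 - 4 * (z * lambda * mu1)) by (apply sqrt_sqrt; lra).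
  assert (Hs : 0 < s).
  { apply Rmult_lt_0_compat; [lra|].
    pose proof (Rmult_lt_0_compat mu2 (1 - z)); lra. }
  assert (Hzl : 0 < z * lambda) by (apply Rmult_lt_0_compat; lra).
  assert (Hzlm : 0 < z * lambda * mu1) by (apply Rmult_lt_0_compat; lra).
  exists ((s - D) / (2 * mu1)), ((s + D) / (2 * mu1)).
  set (x1 := (s - D) / (2 * mu1)); set (x2 := (s + D) / (2 * mu1)).
  assert (Hsum : mu1 * (x1 + x2) = s) by (unfold x1, x2; field; lra).
  assert (Hprod : mu1 * (x1 * x2) = z * lambda).
  { unfold x1, x2.
    replace (mu1 * ((s - D) / (2 * mu1) * ((s + D) / (2 * mu1))))
      with ((s ^ 2 - D * D) / (4 * mu1)) by (field; lra).
    rewrite HD; field; lra. }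
  assert (Hx12 : x1 <= x2).
  { unfold x1, x2, Rdiv; apply Rmult_le_compat_r; [|lra].
    apply Rlt_le, Rinv_0_lt_compat; lra. }
  assert (Hx2 : 0 < x2) by (apply Rdiv_lt_0_compat; lra).
  assert (Hx1 : 0 < x1).
  { apply Rmult_lt_reg_r with x2; trivial.
    apply Rmult_lt_reg_l with mu1; lra. }
  (* The polynomial mu1 (x - x1) (x - x2) at x = 1 and at x = z. *)
  assert (Hp1 : mu1 * ((1 - x1) * (1 - x2)) = (1 - z) * (mu1 - mu2 * z)).
  { transitivity (mu1 - mu1 * (x1 + x2) + mu1 * (x1 * x2)); [ring|].
    rewrite Hsum, Hprod; unfold s; ring. }
  assert (Hpz : mu1 * ((z - x1) * (z - x2)) = z * ((1 - z) * (lambda - mu2 * z))).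
  { transitivity (mu1 * z * z - z * (mu1 * (x1 + x2)) + mu1 * (x1 * x2)); [ring|].
    rewrite Hsum, Hprod; unfold s; ring. }
  assert (Hpos1 : 0 < (1 - x1) * (1 - x2)).
  { apply Rmult_lt_reg_l with mu1; trivial; rewrite Hp1, Rmult_0_r.
    apply Rmult_lt_0_compat; lra. }
  assert (Hx1lt : x1 < 1).
  { destruct (Rlt_le_dec x1 1) as [L|L]; trivial.
    assert (1 <= x1 * x2) by nra.
    assert (mu1 <= mu1 * (x1 * x2)) by nra.
    assert (z * lambda < lambda) by nra.
    lra. }
  assert (Hx2lt : x2 < 1) by nra.
  repeat split; trivial.
  destruct (Rle_lt_dec z x2) as [L|L]; trivial; exfalso.
  assert (Hq : 0 < (z - x1) * (z - x2)) by (apply Rmult_lt_0_compat; lra).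
  apply (Rmult_lt_compat_l mu1) in Hq; trivial.
  rewrite Rmult_0_r, Hpz in Hq.
  destruct Hcase as [Hc|Hc].
  - assert (z * ((1 - z) * (mu2 * z - lambda)) >= 0)
      by (apply Rle_ge, Rmult_le_pos; [lra | apply Rmult_le_pos; lra]).
    lra.
  - assert (x1 * x2 < z * z) by nra.
    assert (mu1 * (x1 * x2) < mu1 * (z * z)) by nra.
    rewrite Hprod in *; nra.
Qed.

(** * The threshold *)

(** [tau] at z = 1 / y^2, multiplied by y^2. *)
Definition tau_cubic (lambda mu1 mu2 y : R) : R :=
  2 * sqrt (lambda * mu1) * y ^ 3 - (lambda + mu1 + mu2) * y ^ 2 + mu2.

Lemma tau_tau_cubic (lambda mu1 mu2 z : R) :
  0 < lambda -> 0 < mu1 -> 0 < z ->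
  tau lambda mu1 mu2 z = z * tau_cubic lambda mu1 mu2 (/ sqrt z).
Proof.
  intros H0 H1 Hz.
  assert (Hr : 0 < sqrt z) by (now apply sqrt_lt_R0).
  assert (Hrr : sqrt z * sqrt z = z) by (apply sqrt_sqrt; lra).
  assert (Hlm : 0 < lambda * mu1) by (now apply Rmult_lt_0_compat).
  unfold tau, tau_cubic; rewrite sqrt_div_alt by trivial.
  rewrite <- Hrr at 1 3; field; lra.
Qed.

Lemma tau_cubic_1 (lambda mu1 mu2 : R) :
  0 < lambda -> 0 < mu1 -> lambda < mu1 -> tau_cubic lambda mu1 mu2 1 < 0.
Proof.
  intros H0 H1 Hlt; unfold tau_cubic; rewrite sqrt_mult by lra.
  assert (Hs : sqrt lambda < sqrt mu1) by (apply sqrt_lt_1; lra).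
  pose proof (sqrt_sqrt lambda) as Ha; pose proof (sqrt_sqrt mu1) as Hb.
  assert (0 < (sqrt mu1 - sqrt lambda) * (sqrt mu1 - sqrt lambda))
    by (apply Rmult_lt_0_compat; lra).
  nra.
Qed.

(** The cubic is positive at 0 and negative at 1, so it has a single root above
    1.  Algebraically: dividing it by the linear factor of a root y > 1 leaves
    the quotient c, whose sign on [1, +oo) follows from the negative value at 1. *)
Lemma tau_cubic_increment (lambda mu1 mu2 y y' : R) :
  0 < lambda -> 0 < mu1 -> 0 < mu2 -> lambda < mu1 ->
  1 < y -> 1 <= y' -> tau_cubic lambda mu1 mu2 y = 0 ->
  exists c, 0 < c /\ tau_cubic lambda mu1 mu2 y' = (y' - y) * c.
Proof.
  intros H0 H1 H2 Hlt Hy Hy' Hroot.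
  pose proof (tau_cubic_1 lambda mu1 mu2 H0 H1 Hlt) as Hone.
  unfold tau_cubic in *.
  assert (Ha : 0 < sqrt (lambda * mu1))
    by (apply sqrt_lt_R0, Rmult_lt_0_compat; lra).
  set (a := sqrt (lambda * mu1)) in *.
  set (s := lambda + mu1 + mu2) in *.
  exists (2 * a * (y * y + y * y' + y' * y') - s * (y + y')).
  split; [|nra].
  assert (Hslope : s * (y + 1) < 2 * a * (y * y + y + 1)).
  { apply Rmult_lt_reg_l with (y - 1); [lra|]; nra. }
  apply Rmult_lt_reg_l with (y + 1); [lra|].
  rewrite Rmult_0_r.
  apply (Rmult_lt_compat_r (y + y')) in Hslope; [|lra].
  assert (Hmono : 0 <= 2 * a * (y * (y' * y' - 1) + y' * (y' - 1))).
  { apply Rmult_le_pos; [lra|].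
    apply Rplus_le_le_0_compat; apply Rmult_le_pos; nra. }
  nra.
Qed.

Lemma tau_cubic_root (lambda mu1 mu2 : R) :
  0 < lambda -> 0 < mu1 -> 0 < mu2 -> lambda < mu1 ->
  exists y, 1 < y /\ tau_cubic lambda mu1 mu2 y = 0.
Proof.
  intros H0 H1 H2 Hlt.
  pose proof (tau_cubic_1 lambda mu1 mu2 H0 H1 Hlt) as Hone.
  set (a := sqrt (lambda * mu1)).
  set (s := lambda + mu1 + mu2).
  assert (Ha : 0 < a) by (apply sqrt_lt_R0, Rmult_lt_0_compat; lra).
  assert (Haa : a * a = lambda * mu1) by (apply sqrt_sqrt; nra).
  assert (Has : a < s) by (unfold s; nra).
  (* At y = s / a the cubic equals s^3 / a^2 + mu2. *)
  assert (Htop : 0 < tau_cubic lambda mu1 mu2 (s / a)).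
  { unfold tau_cubic; fold a s.
    replace (2 * a * (s / a) ^ 3 - s * (s / a) ^ 2 + mu2)
      with (s * (s / a) ^ 2 + mu2) by (field; lra).
    assert (0 <= s * (s / a) ^ 2)
      by (apply Rmult_le_pos; [lra | apply pow2_ge_0]).
    lra. }
  assert (Hsa : 1 < s / a).
  { apply Rmult_lt_reg_r with a; trivial.
    replace (s / a * a) with s by (field; lra); lra. }
  destruct (IVT_cor (tau_cubic lambda mu1 mu2) 1 (s / a)) as [y [[Hy1 Hy2] Hy]].
  - unfold tau_cubic; reg.
  - lra.
  - nra.
  - exists y; split; trivial.
    destruct Hy1 as [L|E]; trivial; subst; lra.
Qed.

Lemma tau_zero (lambda mu1 mu2 : R) :
  0 < lambda -> 0 < mu1 -> 0 < mu2 -> lambda < mu1 ->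
  exists eta, unique (fun z => 0 < z < 1 /\ tau lambda mu1 mu2 z = 0) eta /\
    forall z, eta <= z < 1 -> tau lambda mu1 mu2 z <= 0.
Proof.
  intros H0 H1 H2 Hlt.
  destruct (tau_cubic_root lambda mu1 mu2 H0 H1 H2 Hlt) as [y [Hy Hroot]].
  assert (Hinv : forall z, 0 < z < 1 -> 1 <= / sqrt z).
  { intros z Hz.
    assert (Hr : 0 < sqrt z) by (apply sqrt_lt_R0; lra).
    rewrite <- Rinv_1; apply Rinv_le_contravar; trivial.
    rewrite <- sqrt_1; apply sqrt_le_1; lra. }
  assert (Hiy : 0 < / y < 1).
  { split; [apply Rinv_0_lt_compat; lra|].
    rewrite <- Rinv_1; apply Rinv_lt_contravar; lra. }
  assert (Hsq : sqrt (/ y * / y) = / y) by (apply sqrt_square; lra).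
  assert (Heta : 0 < / y * / y < 1) by nra.
  exists (/ y * / y); split; [split; [split; trivial|]|].
  - rewrite tau_tau_cubic, Hsq, Rinv_inv, Hroot by lra; ring.
  - intros z [Hz Htau].
    rewrite tau_tau_cubic in Htau by lra.
    destruct (tau_cubic_increment lambda mu1 mu2 y (/ sqrt z)) as [c [Hc Hinc]];
      trivial; [now apply Hinv|].
    rewrite Hinc in Htau.
    apply Rmult_integral in Htau; destruct Htau as [|Htau]; [lra|].
    apply Rmult_integral in Htau; destruct Htau as [Htau|]; [|lra].
    replace y with (/ sqrt z) by lra.
    rewrite Rinv_inv; apply sqrt_sqrt; lra.
  - intros z Hz.
    rewrite tau_tau_cubic by lra.
    destruct (tau_cubic_increment lambda mu1 mu2 y (/ sqrt z)) as [c [Hc Hinc]];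
      trivial; [apply Hinv; lra|].
    rewrite Hinc.
    assert (Hle : / sqrt z <= y).
    { rewrite <- (Rinv_inv y); apply Rinv_le_contravar; [lra|].
      rewrite <- Hsq; apply sqrt_le_1; lra. }
    assert (0 <= z * ((y - / sqrt z) * c))
      by (apply Rmult_le_pos; [lra | apply Rmult_le_pos; lra]).
    lra.
Qed.

Lemma tau_nonpos_discriminant (lambda mu1 mu2 z : R) :
  0 < lambda -> 0 < mu1 -> 0 < z -> tau lambda mu1 mu2 z <= 0 ->
  4 * (z * lambda * mu1) <= (z * (lambda + mu1 + mu2 * (1 - z))) ^ 2.
Proof.
  intros H0 H1 Hz Htau; unfold tau in Htau.
  assert (Hq : 0 <= lambda * mu1 / z)
    by (apply Rlt_le, Rdiv_lt_0_compat; trivial; now apply Rmult_lt_0_compat).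
  pose proof (sqrt_sqrt _ Hq) as Hss; pose proof (sqrt_pos (lambda * mu1 / z)) as Hp.
  set (r := sqrt (lambda * mu1 / z)) in *.
  set (b := lambda + mu1 + mu2 * (1 - z)) in *.
  assert (Hb : 2 * r <= b) by (unfold b; lra).
  assert (Hsq : 4 * (r * r) <= b * b) by nra.
  replace (z * lambda * mu1) with (z * z * (r * r)) by (rewrite Hss; field; lra).
  replace ((z * b) ^ 2) with (z * z * (b * b)) by ring.
  apply (Rmult_le_compat_l (z * z)) in Hsq; nra.
Qed.

Lemma rho_discriminant (lambda mu1 mu2 z : R) :
  0 < mu1 -> 0 < z < 1 -> lambda <= mu2 * z ->
  4 * (z * lambda * mu1) <= (z * (lambda + mu1 + mu2 * (1 - z))) ^ 2.
Proof.
  intros H1 Hz Hrho.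
  set (s := z * (lambda + mu1 + mu2 * (1 - z))).
  (* Completing the square: s^2 - 4 z lambda mu1 is a square minus 4 mu1 times
     the value of the characteristic polynomial at z, which is not positive. *)
  assert (Hid : s ^ 2 - 4 * (z * lambda * mu1)
                = (2 * mu1 * z - s) ^ 2
                  + 4 * mu1 * (z * ((1 - z) * (mu2 * z - lambda))))
    by (unfold s; ring).
  assert (0 <= 4 * mu1 * (z * ((1 - z) * (mu2 * z - lambda))))
    by (repeat apply Rmult_le_pos; lra).
  pose proof (pow2_ge_0 (2 * mu1 * z - s)); lra.
Qed.

(** The cases of the theorem differ only in how the discriminant is seen to be
    nonnegative and in which alternative keeps z below the larger root. *)
Lemma R_infty_eigenvector (lambda mu1 mu2 z : R) (M : infmat) :
  0 < lambda -> 0 < mu1 -> 0 < mu2 -> is_R_infty lambda mu1 mu2 M ->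
  0 < z < 1 -> lambda < mu1 -> mu2 * z < mu1 ->
  4 * (z * lambda * mu1) <= (z * (lambda + mu1 + mu2 * (1 - z))) ^ 2 ->
  lambda <= mu2 * z \/ mu1 * z <= lambda ->
  exists w, positive_vec w /\ in_ell1 w /\ left_eigen w M z.
Proof.
  intros H0 H1 H2 HR Hz Hlm Hzm Hdisc Hcase.
  destruct (characteristic_roots lambda mu1 mu2 z)
    as [x1 [x2 [Hx1 [Hx2 [Hzx [Hsum Hprod]]]]]]; trivial.
  set (w := two_root_vec x1 x2 z).
  assert (Hw : positive_vec w) by (apply two_root_vec_pos; lra).
  assert (Hs : ex_series w) by (now apply two_root_vec_ex_series).
  assert (Hgeo : geometric_balance lambda mu1 mu2 z w)
    by (now apply two_root_vec_balance).
  destruct (R_infty_bounds lambda mu1 mu2 M H0 H1 H2 HR) as [HM Hsub].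
  exists w; split; [|split]; trivial.
  - apply (ex_series_ext w); trivial.
    intros j; symmetry; apply Rabs_pos_eq, Rlt_le, Hw.
  - apply subinvariant_left_eigen with lambda mu1 mu2; trivial; try lra.
    + apply HR.
    + apply Hsub; trivial; lra.
Qed.

Theorem theorem4p9 :
  forall (lambda mu1 mu2 : R) (Rinf : infmat),
    0 < lambda -> 0 < mu1 -> 0 < mu2 ->
    lambda < Rmin mu1 mu2 ->
    is_R_infty lambda mu1 mu2 Rinf ->
    exists eta : R,
      unique (fun z => 0 < z < 1 /\ tau lambda mu1 mu2 z = 0) eta /\
      (mu1 <= mu2 ->
        forall z : R, eta <= z < mu1 / mu2 ->
          exists w : infvec,
            positive_vec w /\ in_ell1 w /\ left_eigen w Rinf z) /\
      (mu1 > mu2 ->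
        forall z : R, lambda / mu2 <= z < 1 ->
          exists w : infvec,
            positive_vec w /\ in_ell1 w /\ left_eigen w Rinf z).
Proof.
  intros lambda mu1 mu2 Rinf H0 H1 H2 Hmin HR.
  assert (Hlm : lambda < mu1) by (pose proof (Rmin_l mu1 mu2); lra).
  destruct (tau_zero lambda mu1 mu2 H0 H1 H2 Hlm) as [eta [Hu Hneg]].
  exists eta; split; trivial; split.
  - intros Hle z [Hz1 Hz2].
    destruct Hu as [[Heta _] _].
    apply (Rmult_lt_compat_l mu2) in Hz2; trivial.
    replace (mu2 * (mu1 / mu2)) with mu1 in Hz2 by (field; lra).
    assert (Hz : 0 < z < 1) by (split; nra).
    apply R_infty_eigenvector with lambda mu1 mu2; trivial.
    + apply tau_nonpos_discriminant; trivial; [lra|]; apply Hneg; lra.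
    + (* If z < lambda / mu2, then also z <= lambda / mu1, since mu1 <= mu2. *)
      destruct (Rle_lt_dec lambda (mu2 * z)) as [L|L]; [now left | right; nra].
  - intros Hgt z [Hz1 Hz2].
    apply (Rmult_le_compat_l mu2) in Hz1; [|lra].
    replace (mu2 * (lambda / mu2)) with lambda in Hz1 by (field; lra).
    assert (Hz : 0 < z < 1) by (split; nra).
    apply R_infty_eigenvector with lambda mu1 mu2; trivial.
    + nra.
    + apply rho_discriminant; trivial.
    + now left.
Qed.
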